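(* Let $G$ be a flat pregeometry on a set $M$ and let $f$ be a valid enumeration for $G$. Then the hypergraph $\mathcal{A}_f$ (the $f$-construction of $G$) is a good representation of $G$.
   Context: Pregeometries. A pregeometry $G$ on a (possibly infinite) set $M$ is a function $d=d_G$ from the finite subsets of $M$ to $\mathbb{N}$ such that $d(\emptyset)=0$, $d(A)\le d(A\cup\{x\})\le d(A)+1$, and $d(A\cup B)+d(A\cap B)\le d(A)+d(B)$. A finite $A$ is independent if $d(A)=|A|$; an arbitrary set is independent if all its finite subsets are; $d(Y)=\sup\{|Y_0|: Y_0\subseteq Y \text{ independent}\}$. For finite $A$, $\mathrm{cl}_G(A)=\{x: d(A\cup\{x\})=d(A)\}$, and $\mathrm{cl}_G(Y)=\bigcup\{\mathrm{cl}_G(Y_0): Y_0\subseteq Y\text{ finite}\}$. $Y$ is closed in $G$ if $\mathrm{cl}_G(Y)=Y$. For a finite collection $\Sigma=\{E_1,\dots,E_k\}$ of finite-dimensional closed sets of $G$ let $\Delta_G(\Sigma)=\sum_{\emptyset\ne s\subseteq\{1,\dots,k\}}(-1)^{|s|+1}d_G\left(\bigcap_{i\in s}E_i\right)$. $G$ is flat if $\Delta_G(\Sigma)\ge d_G(\bigcup\Sigma)$ for every such $\Sigma$. Hypergraphs. A hypergraph $\mathcal{A}=(M,R)$ is a set $M$ with a set $R$ of non-empty finite subsets of $M$ (edges). $R[P]=\{e\in R: e\subseteq P\}$. For finite $Y\subseteq M$, $\delta_{\mathcal{A}}(Y)=|Y|-|R[Y]|$; for finite $X\subseteq M$, $d_{\mathcal{A}}(X)=\inf\{\delta_{\mathcal{A}}(Y):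 X\subseteq Y\subseteq M,\ Y\text{ finite}\}$. If $d_{\mathcal{A}}$ is non-negative, it is the dimension function of a pregeometry $G_{\mathcal{A}}$ on $M$. $\mathcal{A}$ is a good representation of $G$ if $G_{\mathcal{A}}=G$ and $d_{\mathcal{A}}(e)=|e|-1$ for every $e\in R$. Valid enumerations. Let $G$ be a flat pregeometry on $M$ and let $X$ be the set of all pairs $(A,F)$ where $F$ is a finite-dimensional closed set of $G$ and $A\subseteq F$ has exactly $d_G(F)+1$ elements. Let $(I,<)$ be a well-ordered set and $f=(f_1,f_2):I\to X$ a bijection. For $n\in\mathbb{N}$ let $I^f_n=\{i\in I: |f_1(i)|=n\}$ and for $F$ closed let $I^f_F=\{i\in I: f_2(i)=F\}$. $f$ is a valid enumeration for $G$ if all the sets $I^f_n$ and $I^f_F$ are intervals of $I$ and $I^f_n<I^f_m$ whenever $n<m$. The $f$-construction (Enumerative Construction). Define by transfinite recursion along $I$ hypergraphs $\mathcal{A}_i=(M,R_i)$: at the minimum of $I$, $R_i=\emptyset$; given $\mathcal{A}_i$, if $d_{\mathcal{A}_i}(f_1(i))=d_G(f_1(i))$ then $R_{i+1}=R_i$, and otherwise $R_{i+1}=R_i\cup\{f_1(i)\}$; at limits $R_i=\bigcup_{j<i}R_j$. Let $R$ be the union of all the stages (including the stage resulting from the last element of $I$, if $I$ has one), and $\mathcal{A}_f=(M,R)$. *)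

(* Defs.v *)
From HB Require Import structures.
From mathcomp Require Import all_boot all_order all_algebra finmap.
From mathcomp Require Import boolp classical_sets functions wochoice.
From mathcomp Require Import constructive_ereal.

Set Implicit Arguments.
Unset Strict Implicit.
Unset Printing Implicit Defensive.

Import Order.TTheory GRing.Theory Num.Theory.

Local Open Scope classical_set_scope.
Local Open Scope ring_scope.

Record pregeometry (M : choiceType) := Pregeometry {
  pdim :> {fset M} -> nat;
  pdim0 : pdim fset0 = 0%N;
  pdimU1 : forall (A : {fset M}) (x : M),
    (pdim A <= pdim (x |` A)%fset <= (pdim A).+1)%N;
  pdim_submod : forall A B : {fset M},
    (pdim (A `|` B)%fset + pdim (A `&` B)%fset <= pdim A + pdim B)%N }.

Section Pregeometry.
Variables (M : choiceType) (G : pregeometry M).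

Definition independent (Y : set M) : Prop :=
  forall A : {fset M}, [set` A] `<=` Y -> G A = #|` A|.

(* The dimension of an arbitrary set. Only finite independent Y0 are used: every
   finite subset of an infinite independent set is independent, so the supremum
   is +oo in that case as well. The default value +oo is never used, because the
   set contains 0 and every subset of \bar int has a supremum. *)
Definition set_dim (Y : set M) : \bar int :=
  supremum +oo%E [set (#|` Y0|%:Z)%:E
    | Y0 in [set Y0 : {fset M} | [set` Y0] `<=` Y /\ independent [set` Y0]]].

Definition fin_dim (Y : set M) : Prop := (set_dim Y < +oo)%E.

Definition cl_fin (A : {fset M}) : set M := [set x | G (x |` A)%fset = G A].

Definition cl (Y : set M) : set M :=
  \bigcup_(Y0 in [set Y0 : {fset M} | [set` Y0] `<=` Y]) cl_fin Y0.

Definition closed_in (Y : set M) : Prop := cl Y = Y.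

(* [fine] is harmless: the intersections are over non-empty index sets, hence
   finite dimensional as soon as the E i are. *)
Definition Delta (k : nat) (E : 'I_k -> set M) : int :=
  \sum_(s : {set 'I_k} | s != finset.set0)
    (-1) ^+ #|s|.+1 * fine (set_dim (\bigcap_(i in [set` s]) E i)).

(* The collection is a finite set, enumerated without repetition; it may be
   empty. *)
Definition flat : Prop :=
  forall (k : nat) (E : 'I_k -> set M), injective E ->
    (forall i, closed_in (E i) /\ fin_dim (E i)) ->
    (set_dim (\bigcup_i E i) <= (Delta E)%:E)%E.

End Pregeometry.

(* A hypergraph on M is identified with its set of edges. *)
Section Hypergraph.
Variables (M : choiceType) (R : set {fset M}).

Definition is_hypergraph : Prop := forall e, R e -> e != fset0.

Definition delta (Y : {fset M}) : int :=
  #|` Y|%:Z - #|` [fset e in fpowerset Y | e \in R]%fset|%:Z.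

(* The infimum may be -oo; the default value +oo is never used, because the set
   contains [delta X] and every subset of \bar int has an infimum. *)
Definition hdim (X : {fset M}) : \bar int :=
  infimum +oo%E [set (delta Y)%:E | Y in [set Y : {fset M} | (X `<=` Y)%fset]].

(* The second conjunct is the equality of the pregeometry of the hypergraph
   with G: a pregeometry is its dimension function. It entails that hdim is
   non-negative, which is what makes the former pregeometry defined. *)
Definition good_representation (G : pregeometry M) : Prop :=
  [/\ is_hypergraph,
      forall X : {fset M}, hdim X = ((G X)%:Z)%:E
    & forall e, R e -> hdim e = (#|` e|%:Z - 1)%:E].

End Hypergraph.

Section WellOrder.
Variables (disp : Order.disp_t) (I : orderType disp).

Definition lt_rel (j i : I) : Prop := (j < i)%O.

Definition is_interval_of (S : set I) : Prop :=
  forall i j, S i -> S j -> forall k, (i <= k <= j)%O -> S k.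

Definition is_succ_of (j i : I) : Prop :=
  (j < i)%O /\ forall k, (j < k)%O -> (i <= k)%O.

Lemma well_order_wf : well_order (<=%O : rel I) -> well_founded lt_rel.
Proof.
move=> wo i; apply: contrapT => nAi.
have [|m [[/asboolP nAm minm] _]] := wo [pred x | `[< ~ Acc lt_rel x >]].
  by exists i; apply/asboolP.
apply: nAm; constructor=> j jm; apply: contrapT => nAj.
have /minm : j \in [pred x | `[< ~ Acc lt_rel x >]] by apply/asboolP.
by rewrite leNgt jm.
Qed.

End WellOrder.

Section Enumeration.
Variables (M : choiceType) (G : pregeometry M).
Variables (disp : Order.disp_t) (I : orderType disp).
Variable f : I -> {fset M} * set M.

Definition enum_pairs : set ({fset M} * set M) :=
  [set p | [/\ closed_in G p.2, fin_dim G p.2, [set` p.1] `<=` p.2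
             & (#|` p.1|%:Z)%:E = (set_dim G p.2 + 1%:E)%E]].

Definition level (n : nat) : set I := [set i | #|` (f i).1| = n].

Definition fiber (F : set M) : set I := [set i | (f i).2 = F].

Definition valid_enumeration : Prop :=
  [/\ set_bij [set: I] enum_pairs f,
      forall n, is_interval_of (level n),
      forall F, closed_in G F -> is_interval_of (fiber F)
    & forall n m, (n < m)%N ->
        forall i j, level n i -> level m j -> (i < j)%O].

Definition step (i : I) (R : set {fset M}) : set {fset M} :=
  if `[< hdim R (f i).1 = ((G (f i).1)%:Z)%:E >] then R
  else R `|` [set (f i).1].

Definition stage_body (i : I) (rec : forall j, lt_rel j i -> set {fset M}) :
    set {fset M} :=
  [set e | (exists j (ji : lt_rel j i), is_succ_of j i /\ step j (rec j ji) e) \/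
           ((~ exists j, is_succ_of j i) /\ exists j (ji : lt_rel j i), rec j ji e)].

Hypothesis wo : well_order (<=%O : rel I).

(* Transfinite recursion; the three equations it is meant to satisfy are
   [stage_min], [stage_succ] and [stage_limit]. *)
Definition stage : I -> set {fset M} :=
  Fix (well_order_wf wo) (fun=> set {fset M}) stage_body.

(* [step i (stage i)] is the stage following [stage i], including when i is the
   last element of I; it contains [stage i], so no stage is left out. *)
Definition f_construction : set {fset M} := \bigcup_i step i (stage i).

Lemma stageE i : stage i = stage_body (fun j (_ : lt_rel j i) => stage j).
Proof.
rewrite /stage Fix_eq // => {}i g h gh; congr stage_body.
by apply: functional_extensionality_dep => j; apply: funext.
Qed.

Lemma is_succ_of_inj (i j k : I) : is_succ_of j i -> is_succ_of k i -> j = k.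
Proof.
move=> [ji jmin] [ki kmin]; case: (ltgtP j k) => // [/jmin|/kmin].
- by rewrite leNgt ki.
- by rewrite leNgt ji.
Qed.

Lemma stage_succ (j i : I) : is_succ_of j i -> stage i = step j (stage j).
Proof.
move=> ji; rewrite stageE; apply/seteqP; split=> [e|e He] /=; last first.
  by left; exists j, ji.1.
case=> [[k [_ [/(is_succ_of_inj ji) <- //]]]|[[]]].
by exists j.
Qed.

Lemma stage_limit (i : I) : (~ exists j, is_succ_of j i) ->
  stage i = \bigcup_(j in [set j | (j < i)%O]) stage j.
Proof.
move=> nj; rewrite stageE; apply/seteqP; split=> [e|e [j ji ej]] /=.
  case=> [[j [_ [ji _]]]|[_ [j [ji ej]]]]; last by exists j.
  by case: nj; exists j.
by right; split=> //; exists j, ji.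
Qed.

Lemma stage_min (i : I) : (forall j, (i <= j)%O) -> stage i = set0.
Proof.
move=> imin; rewrite stage_limit => [|[j [ji _]]]; last first.
  by move: ji; rewrite ltNge imin.
by apply/seteqP; split=> // e [j /=]; rewrite ltNge imin.
Qed.

End Enumeration.

(* Main.v *)
Require Import Defs.
From mathcomp Require Import all_boot all_order all_algebra finmap.
From mathcomp Require Import boolp classical_sets functions wochoice.
From mathcomp Require Import constructive_ereal zify.

Set Implicit Arguments.
Unset Strict Implicit.
Unset Printing Implicit Defensive.

Import Order.TTheory GRing.Theory Num.Theory.

Local Open Scope classical_set_scope.
Local Open Scope ring_scope.

(** Write delta_R(Y) = |Y| - |R[Y]|.  All rests on one invariant: every stage R
    of the construction satisfies G(Y) <= delta_R(Y) for all finite Y, that is,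
    R dominates G.

    Given the invariant at stage R, consider the pair (A, F) treated there.  If
    the rank of A is less than |A| - 1, then the closure of A has rank less
    than that of F, so all the pairs over it came earlier.  Each of them left a
    finite superset Z of its first component with delta_R(Z) <= G(Z); such a Z
    is called tight.  By submodularity unions of tight sets over a common basis
    are tight, so the closure of A is saturated: each of its finite subsets
    lies in a tight one.  Hence A already has the right dimension and is not
    added.  So an added A has rank |A| - 1, spans F, and then every finite Z
    containing A has delta_R(Z) > G(A).

    Adding such an A keeps the invariant if delta_R(Y) >= G(Y) + 1 for each
    finite Y containing A (added_delta_bound), and this is where flatness is
    used.  Let E_1, ..., E_k be F together with the closures of the edges
    inside Y.  Every edge is counted in some E_i, so by inclusion-exclusion
    delta(Y) is the number of points of Y outside the union of the E_i, plus
    the alternating sum of delta(Y \cap E_s) over the non-empty intersections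
    E_s.  If delta(Y \cap E_s) = G(E_s) whenever |s| > 1 and
    delta(Y \cap E_i) >= G(E_i), with 1 to spare for E_i = F, then this sum
    is at least Delta(E) + 1, and flatness gives the bound.  A general Y does
    not satisfy these equalities, but it can be enlarged until it does, without
    raising delta(Y) (flat_delta_bound): the fibres of the enumeration are
    intervals and the levels are increasing, so all the E_s other than F are
    saturated, and tight subsets of a saturated set spanned by Y can be added
    for free.

    At the end every pair has been treated, so every closure of a finite set is
    saturated, which gives the upper bound on the dimension of the hypergraph;
    the invariant gives the lower one. *)

(** * Rank and closure in a pregeometry *)

Section Rank.
Variables (M : choiceType) (G : pregeometry M).
Implicit Types (A B C Y Z : {fset M}) (E F : set M).

Definition restr Y E : {fset M} := [fset x in Y | `[< E x >]]%fset.

Lemma in_restr Y E x : (x \in restr Y E) = (x \in Y) && `[< E x >].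
Proof. by rewrite !inE. Qed.

Lemma restr_sub Y E : (restr Y E `<=` Y)%fset.
Proof. by apply/fsubsetP => x; rewrite in_restr => /andP[]. Qed.

Lemma restr_subset Y E : [set` restr Y E] `<=` E.
Proof. by move=> x /=; rewrite in_restr => /andP[_ /asboolP]. Qed.

Lemma restr_id Y E : [set` Y] `<=` E -> restr Y E = Y.
Proof.
move=> YE; apply/fsetP => x; rewrite in_restr; apply/andb_idr => xY.
by apply/asboolP/YE.
Qed.

Lemma restr_mono Y Z E : (Y `<=` Z)%fset -> (restr Y E `<=` restr Z E)%fset.
Proof.
move=> /fsubsetP YZ; apply/fsubsetP => x.
by rewrite !in_restr => /andP[/YZ -> ->].
Qed.

Lemma sub_restr X Y E : [set` X] `<=` E -> (X `<=` Y)%fset ->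
  (X `<=` restr Y E)%fset.
Proof. by move=> XE XY; rewrite -(restr_id XE) restr_mono. Qed.

Lemma subset_trans_fset A B E :
  (A `<=` B)%fset -> [set` B] `<=` E -> [set` A] `<=` E.
Proof. by move=> /fsubsetP AB BE x /AB /BE. Qed.

Lemma fsetU_subset A B E :
  [set` A] `<=` E -> [set` B] `<=` E -> [set` (A `|` B)%fset] `<=` E.
Proof. by move=> AE BE x /=; rewrite inE => /orP[/AE|/BE]. Qed.

Lemma pdimU A B : (G A <= G (B `|` A)%fset <= #|` B| + G A)%N.
Proof.
elim/fset1U_rect: B => [|x B xB /andP[IH1 IH2]].
  by rewrite fset0U leqnn.
rewrite -fsetUA cardfsU1 xB /=.
have /andP[h1 h2] := pdimU1 G (B `|` A)%fset x.
by rewrite (leq_trans IH1 h1) (leq_trans h2).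
Qed.

Lemma pdim_mono A B : (A `<=` B)%fset -> (G A <= G B)%N.
Proof. by move=> /fsetUidPr <-; rewrite fsetUC; have /andP[] := pdimU A B. Qed.

Lemma pdim_le_card A : (G A <= #|` A|)%N.
Proof.
by have /andP[_] := pdimU fset0 A; rewrite fsetU0 pdim0 addn0.
Qed.

Lemma pdim_submod_sub A B C : (C `<=` A)%fset -> (C `<=` B)%fset ->
  (G (A `|` B)%fset + G C <= G A + G B)%N.
Proof.
move=> CA CB; apply: leq_trans (pdim_submod G A B).
by rewrite leq_add2l pdim_mono // fsubsetI CA.
Qed.

Lemma independent_sub A B : (A `<=` B)%fset -> G B = #|` B| -> G A = #|` A|.
Proof.
move=> AB GB; apply/eqP; rewrite eqn_leq pdim_le_card /=.
have /andP[_] := pdimU A (B `\` A)%fset.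
have -> : (B `\` A `|` A)%fset = B.
  by rewrite fsetUC; apply/fsetP => x; rewrite !inE;
     case: (boolP (x \in A)) => //= /(fsubsetP AB) ->.
rewrite GB; have := cardfsID A B; have -> : (B `&` A)%fset = A.
  exact/fsetIidPr.
lia.
Qed.

(** A maximal independent subset has full rank; built here point by point. *)
Lemma exists_independent_sub C :
  exists B, [/\ (B `<=` C)%fset, G B = #|` B| & G C = #|` B|].
Proof.
elim/fset1U_rect: C => [|x C xC [B [BC GB GC]]].
  by exists fset0; rewrite pdim0 cardfs0.
have [eqG|neG] := eqVneq (G (x |` C)%fset) (G C).
  by exists B; rewrite eqG; split=> //; apply: fsubset_trans (fsubsetU1 _ _).
have /andP[h1 h2] := pdimU1 G C x.
have GxC : G (x |` C)%fset = (G C).+1 by lia.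
have xB : x \notin B by apply: contra xC => /(fsubsetP BC).
exists (x |` B)%fset; rewrite cardfsU1 xB /= add1n GxC GC; split=> //.
  by rewrite fsetUS.
have /andP[_] := pdimU1 G B x; rewrite GB => h3.
(* Adding x to B raises the rank because adding it to C does. *)
have := @pdim_submod_sub (x |` B)%fset C B (fsubsetU1 _ _) BC.
have -> : ((x |` B) `|` C)%fset = (x |` C)%fset.
  by rewrite -fsetUA (fsetUidPr _ _ BC).
by rewrite GxC GB GC; lia.
Qed.

Definition basis E B :=
  [/\ [set` B] `<=` E, G B = #|` B|
    & forall A, [set` A] `<=` E -> (G A <= G B)%N].

Lemma exists_basis E n :
  (forall A, [set` A] `<=` E -> (G A <= n)%N) -> exists B, basis E B.
Proof.
move=> bnd.
pose P m := `[< exists A, [set` A] `<=` E /\ G A = m >].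
have exP : exists m, P m.
  by exists (G fset0); apply/asboolP; exists fset0; split=> // x /=; rewrite inE.
have bP m : P m -> (m <= n)%N by move=> /asboolP[A [/bnd ? <-]].
case: (ex_maxnP exP bP) => m /asboolP[A [AE <-]] maxA.
have [B [BA GB GA]] := exists_independent_sub A.
exists B; split=> //; first exact: subset_trans_fset AE.
move=> C CE; rewrite GB -GA; apply: maxA; apply/asboolP.
by exists C.
Qed.

Lemma basis_set_dim E B : basis E B -> set_dim G E = (#|` B|%:Z)%:E.
Proof.
case=> BE GB maxB; rewrite /set_dim /supremum; case: ifPn => [/eqP S0|_].
  have : set0 ((#|` fset0 : {fset M}|%:Z)%:E : \bar int).
    rewrite -S0; exists fset0 => //; split; first by move=> x /=; rewrite inE.
    move=> A A0; have -> : A = fset0; last by rewrite pdim0 cardfs0.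
    by apply/eqP; rewrite -fsubset0; apply/fsubsetP => x /A0.
  by [].
set S := [set _ | _ in _].
have BS : S (#|` B|%:Z)%:E.
  exists B => //; split=> // A AB; apply: (@independent_sub A B) => //.
  exact/fsubsetP.
have supB : supremums S (#|` B|%:Z)%:E.
  split=> [_ [A [AE indA] <-]|u]; last exact.
  by rewrite lee_fin lez_nat -(indA A) // -GB maxB.
by case: xgetP => [y _ ySup|/(_ _ supB)//]; exact: is_subset1_supremums ySup supB.
Qed.

(** Without a basis the ranks inside E are unbounded, and then the supremum
    defining the dimension of E is infinite. *)
Lemma fin_dim_basis E : fin_dim G E <-> exists B, basis E B.
Proof.
split=> [fE|[B bB]]; last by rewrite /fin_dim (basis_set_dim bB) ltry.
apply: contrapT => nB.
have unb n : exists A, [/\ [set` A] `<=` E, independent G [set` A]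
                        & (n < #|` A|)%N].
  apply: contrapT => nA; apply: nB; apply: (@exists_basis E n) => A AE.
  have [B [BA GB GA]] := exists_independent_sub A.
  rewrite leqNgt; apply/negP => ltn; apply: nA; exists B; rewrite -GA.
  split=> //; first exact: subset_trans_fset AE.
  by move=> C CB; apply: (@independent_sub C B) => //; apply/fsubsetP.
move: fE; rewrite /fin_dim /set_dim; set S := [set _ | _ in _] => fE.
have S_unb n : exists2 m : nat, (n < m)%N & S (m%:Z)%:E.
  by have [A [AE iA nA]] := unb n; exists #|` A| => //; exists A.
have supS : supremums S !=set0.
  exists +oo%E; split=> [u _|u ubu]; first exact: leey.
  case: u ubu => [r|//|] ubu; last by have [m _ /ubu] := S_unb 0%N.
  have [m rm /ubu] := S_unb `|r|%N.
  by rewrite lee_fin; lia.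
have geS t : S t -> (t <= supremum +oo%E S)%E by exact: ge_supremum_Nmem.
case: (supremum +oo%E S) fE geS => [r| |] // _ geS.
  have [m rm /geS] := S_unb `|r|%N; rewrite lee_fin; lia.
by have [m _ /geS] := S_unb 0%N.
Qed.

(** Adding to A points of its closure one at a time never raises the rank, by
    submodularity. *)
Lemma pdim_cl_finU A C : [set` C] `<=` cl_fin G A -> G (C `|` A)%fset = G A.
Proof.
elim/fset1U_rect: C => [_|x C xC IH CA]; first by rewrite fset0U.
have xA : G (x |` A)%fset = G A by apply: CA; rewrite /= fset1U1.
have {}IH : G (C `|` A)%fset = G A.
  by apply: IH => y yC; apply: CA; rewrite /= in_fset1U yC orbT.
have /andP[h _] := pdimU1 G (C `|` A)%fset x.
have := @pdim_submod_sub (x |` A)%fset (C `|` A)%fset A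
  (fsubsetU1 _ _) (fsubsetUr _ _).
have -> : ((x |` A) `|` (C `|` A))%fset = (x |` C `|` A)%fset.
  by apply/fsetP => y; rewrite !inE; do ?case: (_ \in _); do ?case: (_ == _).
rewrite -fsetUA in h *; lia.
Qed.

Lemma pdim_cl_fin A C : [set` C] `<=` cl_fin G A -> (G C <= G A)%N.
Proof. by move=> /pdim_cl_finU <-; apply: pdim_mono; exact: fsubsetUl. Qed.

Lemma sub_cl_fin A : [set` A] `<=` cl_fin G A.
Proof. by move=> x xA; rewrite /cl_fin /= (fsetUidPr _ _ _) // fsub1set. Qed.

Lemma closed_cl_fin_sub E A :
  closed_in G E -> [set` A] `<=` E -> cl_fin G A `<=` E.
Proof. by move=> clE AE x xA; rewrite -clE; exists A. Qed.

Lemma closed_cl_fin A : closed_in G (cl_fin G A).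
Proof.
apply/seteqP; split=> [x [C CA /= xC]|x xA]; last first.
  by exists [fset x]%fset; [move=> y /=; rewrite inE => /eqP ->
                           | apply: sub_cl_fin; rewrite /= inE].
have GCA := pdim_cl_finU CA.
have /andP[h1 _] := pdimU1 G A x.
have := @pdim_submod_sub (x |` C)%fset (C `|` A)%fset C
  (fsubsetU1 _ _) (fsubsetUl _ _).
have : (G (x |` A)%fset <= G ((x |` C) `|` (C `|` A))%fset)%N.
  apply: pdim_mono; apply/fsubsetP => y; rewrite !inE.
  by case: (y == x) => //= ->; rewrite !orbT.
by rewrite /cl_fin /= in xC *; lia.
Qed.

Lemma closed_bigcap (T : Type) (D : set T) (E : T -> set M) :
  (forall i, D i -> closed_in G (E i)) ->
  closed_in G (\bigcap_(i in D) E i).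
Proof.
move=> clE; apply/seteqP; split=> [x [A AE xA] i Di|x xE].
  rewrite -(clE i Di); exists A => // y /AE; exact.
by exists [fset x]%fset; [move=> y /=; rewrite inE => /eqP ->
                         | apply: sub_cl_fin; rewrite /= inE].
Qed.

Lemma closed_cl_finE E A : closed_in G E -> [set` A] `<=` E ->
  (forall C, [set` C] `<=` E -> (G C <= G A)%N) -> E = cl_fin G A.
Proof.
move=> clE AE maxA; apply/seteqP; split=> [x xE|]; last first.
  exact: closed_cl_fin_sub.
apply/eqP; rewrite eqn_leq; have /andP[-> _] := pdimU1 G A x.
rewrite andbT; apply: maxA => y /=; rewrite inE => /orP[|/AE //].
by rewrite inE => /eqP ->.
Qed.

Lemma cl_fin_basis A : exists2 B, basis (cl_fin G A) B & G A = #|` B|.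
Proof.
have [B [BA GB GA]] := exists_independent_sub A.
exists B => //; split=> //.
  by apply: subset_trans_fset BA _; exact: sub_cl_fin.
by move=> C /pdim_cl_fin; rewrite GA GB.
Qed.

End Rank.

(** * The predimension of a hypergraph *)

Section Predimension.
Variables (M : choiceType) (G : pregeometry M).
Implicit Types (R : set {fset M}) (A B X Y Z : {fset M}) (C E F : set M).

Definition edges R Y : {fset {fset M}} := [fset e in fpowerset Y | e \in R]%fset.

Lemma in_edges R Y e : (e \in edges R Y) = (e `<=` Y)%fset && `[< R e >].
Proof. by rewrite !inE fpowersetE. Qed.

Lemma deltaE R Y : delta R Y = #|` Y|%:Z - #|` edges R Y|%:Z.
Proof. by []. Qed.

(** Stated locally, on the edges inside Y: restricting R to the edges that lie
    in given closed sets must not change delta on the subsets of these sets. *)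
Lemma delta_anti R R' Y :
  (forall e, (e `<=` Y)%fset -> R e -> R' e) -> delta R' Y <= delta R Y.
Proof.
move=> RR'; rewrite !deltaE lerD2l lerN2 lez_nat fsubset_leq_card //.
apply/fsubsetP => e; rewrite !in_edges => /andP[eY /asboolP Re].
by rewrite eY; apply/asboolP/RR'.
Qed.

(** An edge inside both A and B lies inside their intersection, whereas the
    union may contain edges that neither of them does. *)
Lemma delta_submod R A B :
  delta R (A `|` B)%fset + delta R (A `&` B)%fset <= delta R A + delta R B.
Proof.
have EI : edges R (A `&` B)%fset = (edges R A `&` edges R B)%fset.
  apply/fsetP => e; rewrite in_fsetI !in_edges fsubsetI.
  by do ?case: (_ `<=` _)%fset; case: `[< _ >].
have EU : (edges R A `|` edges R B `<=` edges R (A `|` B)%fset)%fset.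
  apply/fsubsetP => e; rewrite in_fsetU !in_edges.
  by case/orP => /andP[eY ->]; rewrite fsubsetU ?eY ?orbT.
rewrite !deltaE EI; have := fsubset_leq_card EU.
have := cardfsUI A B; have := cardfsUI (edges R A) (edges R B).
lia.
Qed.

Definition dominates R := forall Y, (G Y)%:Z <= delta R Y.

(** When R dominates G, this is the equality of delta R Z and G Z. *)
Definition tight R Z := delta R Z <= (G Z)%:Z.

Definition saturated R F := forall X, [set` X] `<=` F ->
  exists Z, [/\ (X `<=` Z)%fset, [set` Z] `<=` F & tight R Z].

(** The intersection contains C, so domination keeps its predimension at least
    G C; submodularity then leaves at most G C for the union. *)
Lemma tight_setU R A B (C : {fset M}) : dominates R -> tight R A -> tight R B ->
  (C `<=` A)%fset -> (C `<=` B)%fset -> G C = G A -> G C = G B ->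
  tight R (A `|` B)%fset /\ G (A `|` B)%fset = G C.
Proof.
move=> domR tA tB CA CB GA GB; rewrite /tight in tA tB *.
have h := pdim_submod_sub G CA CB; have hs := delta_submod R A B.
have hd := domR (A `&` B)%fset.
have hU : (G C <= G (A `|` B)%fset)%N by rewrite pdim_mono // fsubsetU ?CA.
have hI : (G C <= G (A `&` B)%fset)%N by rewrite pdim_mono // fsubsetI CA.
by split; lia.
Qed.

(** Domination makes the predimensions natural numbers, so that the infimum is
    a minimum. *)
Lemma hdim_attained R X : dominates R -> exists Y,
  [/\ (X `<=` Y)%fset, hdim R X = (delta R Y)%:E
    & forall Z, (X `<=` Z)%fset -> delta R Y <= delta R Z].
Proof.
move=> domR.
have d0 Y : 0 <= delta R Y by apply: le_trans (domR Y).
pose P m := `[< exists Y, (X `<=` Y)%fset /\ delta R Y = m%:Z >].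
have PY Y : (X `<=` Y)%fset -> P `|delta R Y|%N.
  by move=> XY; apply/asboolP; exists Y; split=> //; rewrite gez0_abs.
have exP : exists m, P m by exists `|delta R X|%N; exact: PY.
case: (ex_minnP exP) => m /asboolP[Y [XY dY]] minm.
have minY Z : (X `<=` Z)%fset -> delta R Y <= delta R Z.
  by move=> /PY /minm; have := d0 Z; rewrite dY; lia.
exists Y; split=> //; rewrite /hdim /infimum; case: ifPn => [/eqP S0|_].
  by have : set0 ((delta R Y)%:E : \bar int) by rewrite -S0; exists Y.
set S := [set _ | _ in _].
have infY : infimums S (delta R Y)%:E.
  split=> [_ [Z XZ <-]|u lbu]; first by rewrite lee_fin minY.
  by apply: lbu; exists Y.
by case: xgetP => [y _ yI|/(_ _ infY)//]; exact: is_subset1_infimums yI infY.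
Qed.

Lemma hdim_eq_pdim R X : dominates R ->
  hdim R X = ((G X)%:Z)%:E <->
  exists2 Z, (X `<=` Z)%fset & delta R Z <= (G X)%:Z.
Proof.
move=> domR; have [Y [XY -> minY]] := hdim_attained X domR.
split=> [[dY]|[Z XZ dZ]]; first by exists Y; rewrite ?dY.
congr EFin; apply/eqP; rewrite eq_le (le_trans (minY _ XZ)) //=.
by apply: le_trans (domR Y); rewrite lez_nat pdim_mono.
Qed.

Definition spans Y E := forall A, [set` A] `<=` E -> (G A <= G (restr Y E))%N.

Lemma spans_mono Y Z E : (Y `<=` Z)%fset -> spans Y E -> spans Z E.
Proof.
move=> YZ sY A /sY h; apply: leq_trans h _.
exact/pdim_mono/restr_mono.
Qed.

Lemma spans_basis Y E B : basis G E B -> (B `<=` Y)%fset -> spans Y E.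
Proof.
move=> [BE GB maxB] BY A /maxB h; apply: leq_trans h _.
exact/pdim_mono/sub_restr.
Qed.

Lemma spans_pdim Y E B : spans Y E -> basis G E B -> G (restr Y E) = #|` B|.
Proof.
move=> sY [BE GB maxB]; apply/eqP; rewrite eqn_leq -GB.
by rewrite sY // maxB //; exact: restr_subset.
Qed.

(** The move by which finite sets are enlarged for free.  Inside C, the set Z
    meets Y exactly in Y \cap E \cap C; if Z \cap C is tight and Y spans
    E \cap C, then submodularity shows that adding Z costs nothing. *)
Lemma delta_absorb R Y Z E C : dominates R ->
  (restr Y E `<=` Z)%fset -> [set` Z] `<=` E ->
  delta R (restr Z C) <= (G (restr Y (E `&` C)))%:Z ->
  delta R (restr (Y `|` Z)%fset C) <= delta R (restr Y C).
Proof.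
move=> domR YZ ZE dZ.
have -> : restr (Y `|` Z)%fset C = (restr Y C `|` restr Z C)%fset.
  by apply/fsetP => x; rewrite !inE andb_orl.
have h := delta_submod R (restr Y C) (restr Z C).
have eI : (restr Y C `&` restr Z C)%fset = restr Y (E `&` C).
  apply/fsetP => x; rewrite in_fsetI !in_restr.
  apply/andP/andP => [[/andP[xY xC] /andP[/ZE xE _]]|[xY /asboolP[xE xC]]].
    by split=> //; apply/asboolP; split=> //; apply/asboolP.
  rewrite xY; split; first exact/asboolP.
  apply/andP; split; last exact/asboolP.
  by apply: (fsubsetP YZ); rewrite in_restr xY; apply/asboolP.
rewrite eI in h; have := domR (restr Y (E `&` C)); lia.
Qed.

End Predimension.

(** * Inclusion-exclusion *)

(** For a fixed u, let T be the set of i with P i u.  The alternating sum over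
    the subsets of T is the expansion of the product of the factors
    1 - [P i u], which is 1 or 0 according to whether T is empty. *)
Lemma incl_excl (T : choiceType) (U : {fset T}) (k : nat) (P : 'I_k -> pred T) :
  #|` [fset u in U | [exists i, P i u]]%fset|%:Z =
  \sum_(s : {set 'I_k} | s != finset.set0)
    (-1) ^+ #|s|.+1 * #|` [fset u in U | [forall i in s, P i u]]%fset|%:Z.
Proof.
have cardE (Q : pred T) :
    #|` [fset u in U | Q u]%fset|%:Z = \sum_(u <- U) (Q u)%:Z :> int.
  have -> : #|` [fset u in U | Q u]%fset| = (\sum_(u <- U) Q u)%N.
    by rewrite card_imfset //= size_filter -sumn_count sumnE big_map.
  by rewrite -natz natr_sum; apply: eq_bigr => u _; rewrite natz.
rewrite cardE; under [RHS]eq_bigr => s _ do rewrite cardE big_distrr.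
rewrite exchange_big /=; apply: eq_bigr => u _.
have prodE : \prod_(i < k) (- (P i u)%:Z + 1) = 1 - [exists i, P i u]%:Z :> int.
  case: (boolP [exists i, P i u]) => [/existsP[i Pi]|/existsPn nP].
    by rewrite (bigD1 i) //= Pi addNr mul0r.
  by rewrite big1 ?subr0 // => i _; rewrite (negbTE (nP i)) add0r.
have : \prod_(i < k) (- (P i u)%:Z + 1) =
       \sum_(s : {set 'I_k}) (-1) ^+ #|s| * [forall i in s, P i u]%:Z :> int.
  rewrite bigA_distr; apply: eq_bigr => s _.
  case: (boolP [forall i in s, P i u]) => [/forall_inP Ps|].
    rewrite mulr1 -prodr_const (bigID (mem s)) /= [X in _ * X]big1 ?mulr1.
      by apply: eq_bigr => i si; rewrite si Ps.
    by move=> i si; rewrite (negbTE si).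
  rewrite negb_forall_in => /exists_inP[i si nPi].
  by rewrite mulr0 (bigD1 i) //= si (negbTE nPi) oppr0 mul0r.
rewrite prodE.
rewrite (bigD1 finset.set0) //= cards0 expr0 mul1r.
have -> : [forall i in (finset.set0 : {set 'I_k}), P i u].
  by apply/forall_inP => i; rewrite inE.
move=> prodS; rewrite [RHS](eq_bigr (fun s : {set 'I_k} =>
   - ((-1) ^+ #|s| * [forall i in s, P i u]%:Z))); last first.
  by move=> s _; rewrite exprS mulN1r mulNr.
rewrite sumrN; move: prodS; set S := \sum_(_ | _) _; lia.
Qed.

(** * Flatness bounds the predimension *)

Section FlatBound.
Variables (M : choiceType) (G : pregeometry M) (k : nat) (E : 'I_k -> set M).
Variable R : set {fset M}.
Hypothesis domR : dominates G R.
Implicit Types (A B X Y Z : {fset M}) (C : set M) (s t u : {set 'I_k}).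

Definition capE s : set M := \bigcap_(i in [set` s]) E i.

Lemma capEU s t : capE (s :|: t) = capE s `&` capE t.
Proof.
apply/seteqP; split=> [x h|x [hs ht] i /=]; last first.
  by rewrite inE => /orP[/hs|/ht].
by split=> i /= it; apply: h; rewrite /= inE it ?orbT.
Qed.

Lemma capE_anti s t : s \subset t -> capE t `<=` capE s.
Proof. by move=> /fintype.subsetP st x xt i /st; apply: xt. Qed.

Lemma capE0 : capE finset.set0 = setT.
Proof. by apply/seteqP; split=> // x _ i /=; rewrite inE. Qed.

Lemma capE1 i : capE (finset.set1 i) = E i.
Proof.
apply/seteqP; split=> [x h|x xE j /=]; first by apply: h; rewrite /= inE.
by rewrite inE => /eqP ->.
Qed.

Lemma capE_subE s i : i \in s -> capE s `<=` E i.
Proof. by move=> si x; apply. Qed.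

(** The stronger form of saturation needed for absorption: a tight Z inside
    capE t may meet a smaller intersection capE s in a set that is not tight,
    and adding it would then raise the predimension inside capE s. *)
Definition hereditarily_saturated t := forall X, [set` X] `<=` capE t ->
  exists Z, [/\ (X `<=` Z)%fset, [set` Z] `<=` capE t
    & forall s, t \subset s -> tight G R (restr Z (capE s))].

(** The sets Y \cap capE t are made tight one t after the other.  No step
    spoils the previous ones, because Z \cap capE u = Z \cap capE (t :|: u)
    is tight for every u, so that delta_absorb applies inside each capE u at
    once. *)
Lemma tighten (L : seq {set 'I_k}) Y :
  (forall t, t \in L -> hereditarily_saturated t) ->
  (forall t s, t \in L -> t \subset s -> spans G Y (capE s)) ->
  exists Y', [/\ (Y `<=` Y')%fset,
    forall C, [set` Y] `<=` C -> (forall t, t \in L -> capE t `<=` C) ->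
      [set` Y'] `<=` C,
    forall u, delta R (restr Y' (capE u)) <= delta R (restr Y (capE u))
    & forall t, t \in L -> tight G R (restr Y' (capE t))].
Proof.
elim: L => [_ _|t L IH satL spL]; first by exists Y; split.
have [|t' s t'L|Y1 [YY1 Y1C dY1 tY1]] := IH.
- by move=> t' t'L; apply: satL; rewrite inE t'L orbT.
- by apply: spL; rewrite inE t'L orbT.
have [Z [Y1Z Zt tZ]] := satL t (mem_head _ _) _ (@restr_subset _ Y1 (capE t)).
have dec u : delta R (restr (Y1 `|` Z)%fset (capE u)) <=
             delta R (restr Y1 (capE u)).
  apply: (delta_absorb domR Y1Z Zt); rewrite -capEU.
  have -> : restr Z (capE u) = restr Z (capE (t :|: u)).
    rewrite capEU; apply/fsetP => x; rewrite !in_restr.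
    apply: andb_id2l => xZ; congr asbool; rewrite propeqE.
    by split=> [|[]]; first by split=> //; exact: Zt.
  apply: le_trans (tZ _ (finset.subsetUl _ _)) _; rewrite lez_nat.
  have tsp : spans G Y1 (capE (t :|: u)).
    by apply: spans_mono YY1 _; apply: spL (mem_head _ _) (finset.subsetUl _ _).
  by apply: tsp; exact: restr_subset.
exists (Y1 `|` Z)%fset; split.
- by rewrite fsubsetU ?YY1.
- move=> C YC LC; apply: fsetU_subset.
    by apply: Y1C => // t' t'L; apply: LC; rewrite inE t'L orbT.
  by move=> x /Zt; apply: LC; exact: mem_head.
- by move=> u; apply: le_trans (dec u) (dY1 u).
- move=> t'; rewrite inE => /orP[/eqP ->|t'L].
    have -> : restr (Y1 `|` Z)%fset (capE t) = restr Z (capE t).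
      apply/fsetP => x; rewrite !in_restr inE andb_orl.
      apply/orb_idl => xY1t; have xZ : x \in Z.
        by apply: (fsubsetP Y1Z); rewrite in_restr.
      by move: xY1t => /andP[_ ->]; rewrite xZ.
    exact: tZ.
  apply: le_trans (dec t') _; apply: le_trans (tY1 t' t'L) _.
  by rewrite lez_nat pdim_mono // restr_mono // fsubsetUl.
Qed.

Hypothesis E_closed : forall i, closed_in G (E i).
Hypothesis E_fin : forall i, fin_dim G (E i).

Lemma capE_basis s : s != finset.set0 -> exists B, basis G (capE s) B.
Proof.
move=> /set0Pn[i si]; have [B [_ _ maxB]] := (fin_dim_basis G (E i)).1 (E_fin i).
apply: (@exists_basis _ _ _ (G B)) => A As; apply: maxB => x /As.
exact: capE_subE.
Qed.

Lemma common_basis : exists B, forall s, s != finset.set0 ->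
  spans G (restr B (capE s)) (capE s).
Proof.
suff [B sB] : exists B, forall s, s \in enum {set 'I_k} ->
    s != finset.set0 -> exists2 B', basis G (capE s) B' & (B' `<=` B)%fset.
  exists B => s s0; have [|B' bB' B'B] := sB s _ s0; first by rewrite mem_enum.
  by apply: (spans_basis bB'); apply: sub_restr => //; case: bB'.
elim: (enum _) => [|s L [B sB]]; first by exists fset0.
have [s0|s0] := eqVneq s finset.set0.
  exists B => t; rewrite inE => /orP[/eqP -> |/sB //].
  by rewrite s0 eqxx.
have [B' bB'] := capE_basis s0; exists (B `|` B')%fset => t.
rewrite inE => /orP[/eqP -> _|tL t0].
  by exists B' => //; exact: fsubsetUr.
have [B2 b2 B2B] := sB t tL t0; exists B2 => //.
by rewrite fsubsetU ?B2B.
Qed.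

(** By induction from the smallest intersections upwards: a tight set in
    capE t is corrected inside all the proper supersets of t by tighten, and
    its own predimension does not increase in the process. *)
Lemma saturated_hereditary t : t != finset.set0 ->
  (forall s, t \subset s -> saturated G R (capE s)) -> hereditarily_saturated t.
Proof.
have [B spB] := common_basis.
have [n] := ubnP (k - #|t|); elim: n t => // n IH t ltn t0 satt X Xt.
have [|Z0 [XZ0 Z0t tZ0]] := satt t (subxx _) (X `|` restr B (capE t))%fset.
  by apply: fsetU_subset => //; exact: restr_subset.
have spZ0 s : t \subset s -> spans G Z0 (capE s).
  move=> ts; have s0 : s != finset.set0.
    by apply: contra_neq t0 => s0; apply/eqP; rewrite -finset.subset0 -s0.
  apply: spans_mono (spB s s0); apply: fsubset_trans XZ0.
  apply: fsubset_trans (fsubsetUr _ _); apply: sub_restr (restr_sub _ _).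
  by move=> x /(restr_subset (E := capE s)); exact: capE_anti.
have [||Z [Z0Z Zt dZ tZ]] := @tighten [seq s : {set 'I_k} <- enum {set 'I_k} | t \proper s] Z0.
- move=> s; rewrite mem_filter => /andP[ts _]; apply: IH.
  + have := proper_card ts; have := max_card s; rewrite card_ord; lia.
  + apply: contraTneq ts => ->.
    by rewrite properE finset.subset0 negb_and negbK finset.sub0set orbT.
  + by move=> u su; apply: satt; exact: fintype.subset_trans (proper_sub ts) su.
- move=> s u; rewrite mem_filter => /andP[ts _] su; apply: spZ0.
  exact: fintype.subset_trans (proper_sub ts) su.
have ZEt : [set` Z] `<=` capE t.
  apply: Zt => // s; rewrite mem_filter => /andP[ts _].
  exact/capE_anti/proper_sub.
exists Z; split=> //.
  by apply: fsubset_trans Z0Z; apply: fsubset_trans XZ0; exact: fsubsetUl.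
move=> s ts; have [<-|st] := eqVneq t s; last first.
  by apply: tZ; rewrite mem_filter mem_enum finset.properEneq st ts.
have := dZ t; rewrite (restr_id ZEt) (restr_id Z0t) => dZt.
apply: le_trans dZt _; apply: le_trans tZ0 _.
by rewrite lez_nat pdim_mono.
Qed.

(** Inclusion-exclusion is applied to the points of Y in the union of the E i,
    and to the edges inside Y: such an edge is inside Y \cap capE s exactly
    when it is inside E i for all i in s. *)
Lemma delta_incl_excl Y :
  (forall e, R e -> (e `<=` Y)%fset -> exists i, [set` e] `<=` E i) ->
  delta R Y = #|` Y|%:Z - #|` restr Y (\bigcup_i E i)|%:Z +
    \sum_(s : {set 'I_k} | s != finset.set0)
      (-1) ^+ #|s|.+1 * delta R (restr Y (capE s)).
Proof.
move=> RE.
have pointE : restr Y (\bigcup_i E i) =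
    [fset x in Y | [exists i, `[< E i x >]]]%fset.
  apply/fsetP => x; rewrite in_restr !inE; congr (_ && _).
  apply/asboolP/existsP => [[i _ xi]|[i /asboolP xi]]; last by exists i.
  by exists i; apply/asboolP.
have edgeE : edges R Y =
    [fset e in edges R Y | [exists i, `[< ([set` e] `<=` E i)%classic >]]]%fset.
  apply/fsetP => e; rewrite !inE fpowersetE; apply/esym/andb_idr.
  move=> /andP[eY /asboolP Re]; apply/existsP.
  by have [i ei] := RE e Re eY; exists i; apply/asboolP.
rewrite pointE incl_excl deltaE {1}edgeE incl_excl.
rewrite [X in _ = _ + X](_ : _ = \sum_(s : {set 'I_k} | s != finset.set0)
      ((-1) ^+ #|s|.+1 * #|` [fset u in Y | [forall i in s, `[< E i u >]]]%fset|%:Z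
       - (-1) ^+ #|s|.+1 * #|` [fset u in edges R Y |
            [forall i in s, `[< ([set` u] `<=` E i)%classic >]]]%fset|%:Z)); last first.
  apply: eq_bigr => s _; rewrite -mulrBr deltaE; congr (_ * (_%:Z - _%:Z)).
    congr (#|` _|); apply/fsetP => x; rewrite in_restr !inE; congr (_ && _).
    apply/asboolP/forall_inP => [xs i si|xs i si].
      by apply/asboolP; apply: xs.
    by apply/asboolP/xs.
  congr (#|` _|); apply/fsetP => e; rewrite in_edges !inE fpowersetE.
  rewrite andbAC; congr (_ && _).
  apply/idP/andP => [es|[eY /forall_inP es]].
    split; first exact: fsubset_trans es (restr_sub _ _).
    apply/forall_inP => i si; apply/asboolP => x /(fsubsetP es).
    by rewrite in_restr => /andP[_ /asboolP]; apply.
  by apply: sub_restr => // x xe i /= /es /asboolP; apply.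
by rewrite sumrB addrA subrK.
Qed.

(** How flatness bounds predimensions from below.  All the intersections except
    E i0 itself are saturated, and c measures how far E i0 is from that.
    First, Y is enlarged inside the E i with i != i0 until it spans every
    capE s: this is free because Y spans E i, and a set s of at least two
    indices contains some i != i0.  Then tighten makes Y \cap capE s tight
    for |s| > 1.  In the formula of delta_incl_excl the terms with |s| > 1,
    whose signs vary, are now those of Delta; the terms with |s| = 1 are
    positive and only grow. *)
Lemma flat_delta_bound (i0 : 'I_k) (c : int) Y :
  flat G -> injective E ->
  (forall e, R e -> exists i, [set` e] `<=` E i) ->
  (forall s, s != finset.set0 -> s != finset.set1 i0 -> saturated G R (capE s)) ->
  (forall i, spans G Y (E i)) ->
  (forall W, (Y `<=` W)%fset ->
     (G (restr W (E i0)))%:Z + c <= delta R (restr W (E i0))) ->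
  (G Y)%:Z + c <= delta R Y.
Proof.
move=> Gflat Einj RE satE spY bndY.
have [B spB] := common_basis.
have [Y1 [YY1 dY1 BY1]] : exists Y1, [/\ (Y `<=` Y1)%fset, delta R Y1 <= delta R Y
    & forall i, i != i0 -> (restr B (E i) `<=` Y1)%fset].
  suff [Y1 [YY1 dY1 BY1]] : exists Y1, [/\ (Y `<=` Y1)%fset,
      delta R Y1 <= delta R Y & forall i, i \in enum 'I_k -> i != i0 ->
        (restr B (E i) `<=` Y1)%fset].
    by exists Y1; split=> // i; apply: BY1; rewrite mem_enum.
  elim: (enum _) => [|i L [Y1 [YY1 dY1 BY1]]]; first by exists Y.
  have [ii0|ii0] := eqVneq i i0.
    exists Y1; split=> // j; rewrite inE => /orP[/eqP ->|/BY1 //].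
    by rewrite ii0 eqxx.
  have sati : saturated G R (E i).
    rewrite -capE1; apply: satE; last by apply: contra ii0 => /eqP/set1_inj ->.
    by apply/set0Pn; exists i; rewrite inE.
  have [|Z [XZ Zi tZ]] := sati (restr Y1 (E i) `|` restr B (E i))%fset.
    by apply: fsetU_subset; exact: restr_subset.
  have Y1Z : (restr Y1 (E i) `<=` Z)%fset.
    by apply: fsubset_trans XZ; exact: fsubsetUl.
  have BZ : (restr B (E i) `<=` Z)%fset.
    by apply: fsubset_trans XZ; exact: fsubsetUr.
  exists (Y1 `|` Z)%fset; split.
  - by rewrite fsubsetU ?YY1.
  - apply: le_trans dY1.
    rewrite -(restr_id (@subsetT _ [set` (Y1 `|` Z)%fset])).
    rewrite -{2}(restr_id (@subsetT _ [set` Y1])).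
    apply: (delta_absorb domR Y1Z Zi); rewrite setIT restr_id //.
    apply: le_trans tZ _; rewrite lez_nat.
    by apply: (spans_mono YY1 (spY i)).
  - move=> j; rewrite inE => /orP[/eqP -> _|jL ji0].
      by rewrite fsubsetU ?BZ ?orbT.
    by rewrite fsubsetU ?BY1.
have spY1 s : s != finset.set0 -> spans G Y1 (capE s).
  move=> s0; have [-> |si0] := eqVneq s (finset.set1 i0).
    by rewrite capE1; exact: spans_mono YY1 _.
  have [i si ii0] : exists2 i, i \in s & i != i0.
    apply: contrapT => nex; case/negP: si0.
    have sub : s \subset finset.set1 i0.
      apply/fintype.subsetP => i si; rewrite inE; apply: contrapT => /negP ii0.
      by apply: nex; exists i.
    by move: sub; rewrite finset.subset1 (negbTE s0) orbF.
  apply: spans_mono (spB s s0); apply: fsubset_trans (BY1 i ii0).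
  apply: sub_restr (restr_sub _ _) => x /(restr_subset (E := capE s)).
  exact: capE_subE.
pose big s := (1 < #|s|)%N.
have big0 s t : big s -> s \subset t -> t != finset.set0 /\ t != finset.set1 i0.
  move=> bs /subset_leq_card st; have {st} bt := leq_trans bs st.
  by split; apply: contraTneq bt => ->; rewrite ?cards0 ?cards1.
have [||Y2 [Y12 _ dY2 tY2]] := @tighten [seq s <- enum {set 'I_k} | big s] Y1.
- move=> t; rewrite mem_filter => /andP[bt _].
  have [t0 _] := big0 _ _ bt (subxx t).
  apply: saturated_hereditary => // s ts.
  by have [] := big0 _ _ bt ts; exact: satE.
- move=> t s; rewrite mem_filter => /andP[bt _] ts; apply: spY1.
  by have [] := big0 _ _ bt ts.
have {dY2} dY2 : delta R Y2 <= delta R Y.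
  apply: le_trans dY1; have := dY2 finset.set0.
  by rewrite capE0 !restr_id.
have YY2 : (Y `<=` Y2)%fset by exact: fsubset_trans Y12.
have spY2 s : s != finset.set0 -> spans G Y2 (capE s).
  by move=> /spY1; exact: spans_mono.
have dimE s : s != finset.set0 ->
    fine (set_dim G (capE s)) = (G (restr Y2 (capE s)))%:Z.
  move=> s0; have [B' bB'] := capE_basis s0.
  by rewrite (basis_set_dim bB') (spans_pdim (spY2 s s0) bB').
have sumE : Delta G E + c <= \sum_(s : {set 'I_k} | s != finset.set0)
      (-1) ^+ #|s|.+1 * delta R (restr Y2 (capE s)).
  have i00 : finset.set1 i0 != finset.set0.
    by apply/set0Pn; exists i0; rewrite inE.
  rewrite /Delta (bigD1 (finset.set1 i0)) //= [leRHS](bigD1 (finset.set1 i0)) //=.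
  rewrite addrAC; apply: lerD.
    rewrite -/(capE _) dimE // cards1 expr2 mulN1r opprK !mul1r capE1.
    exact: bndY.
  apply: ler_sum => s /andP[s0 si0]; rewrite -/(capE s) dimE //.
  have [bs|] := boolP (big s).
    have ts : tight G R (restr Y2 (capE s)).
      by apply: tY2; rewrite mem_filter bs mem_enum.
    rewrite (_ : delta R _ = (G (restr Y2 (capE s)))%:Z) //.
    by apply/eqP; rewrite eq_le; apply/andP; split; [exact: ts|exact: domR].
  rewrite /big -leqNgt => s1; have -> : #|s| = 1%N.
    by apply/eqP; rewrite eqn_leq s1 card_gt0.
  by rewrite expr2 mulN1r opprK !mul1r; exact: domR.
have unionE : (G (restr Y2 (\bigcup_i E i)))%:Z <= Delta G E.
  have := Gflat k E Einj (fun i => conj (E_closed i) (E_fin i)) => leD.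
  have /fin_dim_basis[B' bB'] : fin_dim G (\bigcup_i E i).
    by rewrite /fin_dim; apply: le_lt_trans leD (ltry _).
  move: leD; rewrite (basis_set_dim bB') lee_fin; apply: le_trans.
  case: bB' => _ <- maxB'; rewrite lez_nat; apply: maxB'.
  exact: restr_subset.
have GY : (G Y <= G Y2)%N by exact: pdim_mono.
have GY2 : (G Y2 <= #|` (Y2 `\` restr Y2 (\bigcup_i E i))%fset|
               + G (restr Y2 (\bigcup_i E i)))%N.
  have /andP[_] := pdimU G (restr Y2 (\bigcup_i E i))
    (Y2 `\` restr Y2 (\bigcup_i E i))%fset.
  rewrite fsetUC; suff -> : (restr Y2 (\bigcup_i E i) `|`
    Y2 `\` restr Y2 (\bigcup_i E i))%fset = Y2 by [].
  by rewrite -[RHS](fsetID (restr Y2 (\bigcup_i E i)))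
     (fsetIidPr (restr_sub _ _)).
have cardY2 := cardfsID (restr Y2 (\bigcup_i E i)) Y2.
rewrite (fsetIidPr (restr_sub _ _)) in cardY2.
have := @delta_incl_excl Y2 (fun e Re _ => RE e Re).
lia.
Qed.

End FlatBound.

(** A finite subset X of F is covered by the sets x |` B with x in X, and their
    tight supersets, all of the rank of B, glue together along B. *)
Lemma saturated_of_small (M : choiceType) (G : pregeometry M)
    (R : set {fset M}) (F : set M) (B : {fset M}) :
  dominates G R -> closed_in G F -> basis G F B ->
  (forall A : {fset M}, [set` A] `<=` F -> #|` A| = #|` B|.+1 -> G A = #|` B| ->
     exists2 Z, (A `<=` Z)%fset & delta R Z <= (G A)%:Z) ->
  saturated G R F.
Proof.
move=> domR clF [BF GB maxB] small X XF.
suff [Z [XZ tZ BZ GZ]] : exists Z, [/\ (X `<=` Z)%fset, tight G R Z,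
    (B `<=` Z)%fset & G Z = G B].
  exists Z; split=> //; rewrite (closed_cl_finE clF BF maxB) => x xZ.
  apply/eqP; rewrite eqn_leq; have /andP[-> _] := pdimU1 G B x.
  by rewrite andbT -GZ pdim_mono // fsubUset BZ fsub1set xZ.
elim/fset1U_rect: X XF => [_|x X _ IH XF].
  exists B; split=> //; rewrite /tight deltaE GB; lia.
have [|Z [XZ tZ BZ GZ]] := IH.
  by apply: subset_trans_fset XF; exact: fsubsetU1.
have [xB|xB] := boolP (x \in B).
  exists Z; split=> //.
  by rewrite fsubUset XZ fsub1set (fsubsetP BZ).
have xF : F x by apply: XF; rewrite /= fset1U1.
have AF : [set` (x |` B)%fset] `<=` F.
  by apply: fsetU_subset => // y /=; rewrite inE => /eqP ->.
have GA : G (x |` B)%fset = G B.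
  by apply/eqP; rewrite eqn_leq maxB //= pdim_mono // fsubsetU1.
have [||Z' AZ' dZ'] := small _ AF; first by rewrite cardfsU1 xB.
  by rewrite GA GB.
have BZ' : (B `<=` Z')%fset by apply: fsubset_trans AZ'; exact: fsubsetU1.
have GZ' : G Z' = G B.
  by have := domR Z'; have := pdim_mono G AZ'; lia.
have tZ' : tight G R Z' by rewrite /tight GZ' -GA.
have [tU GU] := tight_setU domR tZ tZ' BZ BZ' (esym GZ) (esym GZ').
exists (Z `|` Z')%fset; split=> //; last by rewrite fsubsetU ?BZ.
rewrite fsubUset [X in _ && X]fsubsetU ?XZ // andbT fsub1set inE.
by rewrite (fsubsetP AZ') ?orbT // fset1U1.
Qed.

(** * The enumerative construction *)

Section Construction.
Variables (M : choiceType) (G : pregeometry M).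
Hypothesis G_flat : flat G.
Variables (disp : Order.disp_t) (I : orderType disp).
Hypothesis I_wo : well_order (@Order.le disp I).
Variable f : I -> {fset M} * set M.
Hypothesis f_valid : valid_enumeration G f.
Implicit Types (A B X Y Z e : {fset M}) (F H : set M) (i j : I).

Local Notation stage := (stage G f I_wo).

Definition added j := hdim (stage j) (f j).1 <> ((G (f j).1)%:Z)%:E.

(** The stages, their successors and the final hypergraph are all of this form,
    for D an initial segment of I. *)
Definition built (D : set I) : set {fset M} :=
  [set e | exists j, [/\ D j, (f j).1 = e & added j]].

Lemma stepE j e : step G f j (stage j) e <->
  stage j e \/ ((f j).1 = e /\ added j).
Proof.
rewrite /step; case: asboolP => [nj|aj].
  by split=> [|[//|[_]]]; [left|rewrite /added].
by split=> [[|/= ->]|[|[<- _]]]; [left|right|left|right].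
Qed.

Lemma stage_built i : stage i = built [set j | (j < i)%O].
Proof.
elim/(well_founded_ind (well_order_wf I_wo)): i => i IH.
apply/seteqP; split=> e.
  have [[j ji]|nsucc] := pselect (exists j, is_succ_of j i).
    rewrite (stage_succ G f I_wo ji) => /stepE[|[<- aj]]; last first.
      by exists j; split=> //; exact: ji.1.
    rewrite (IH j ji.1) => -[k [/= kj <- ak]]; exists k; split=> //=.
    exact: lt_trans kj ji.1.
  rewrite (stage_limit G f I_wo nsucc) => -[j /= ji]; rewrite (IH j ji).
  by case=> k [/= kj <- ak]; exists k; split=> //=; exact: lt_trans kj ji.
case=> j [/= ji je aj].
have [[k ki]|nsucc] := pselect (exists k, is_succ_of k i).
  rewrite (stage_succ G f I_wo ki); apply/stepE.
  have := leNgt j k; case: (ltgtP j k) => [jk _|kj _|jk _].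
  - by left; rewrite (IH k ki.1); exists j.
  - by have := ki.2 j kj; rewrite leNgt ji.
  - by right; rewrite -jk.
rewrite (stage_limit G f I_wo nsucc).
have [k [jk ki]] : exists k, (j < k)%O /\ (k < i)%O.
  apply: contrapT => nk; apply: nsucc; exists j; split=> // k jk.
  by rewrite leNgt; apply/negP => ki; apply: nk; exists k.
by exists k => //=; rewrite (IH k ki); exists j.
Qed.

Lemma step_built i : step G f i (stage i) = built [set j | (j <= i)%O].
Proof.
apply/seteqP; split=> e.
  rewrite stepE stage_built => -[[j [/= /ltW ji je aj]]|[ie ai]].
    by exists j.
  by exists i; split=> //=.
case=> j [/=]; rewrite le_eqVlt stepE => /orP[/eqP ->|ji] je aj.
  by right.
by left; rewrite stage_built; exists j.
Qed.

Lemma f_construction_built : f_construction G f I_wo = built setT.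
Proof.
apply/seteqP; split=> [e [i _]|e [j [_ je aj]]].
  by rewrite step_built => -[j [_ je aj]]; exists j.
by exists j => //; apply/stepE; right.
Qed.

(** Only finitely many edges lie inside a given Y, so they have all appeared at
    the latest of their indices. *)
Lemma dominates_built (D : set I) :
  (forall j, D j -> dominates G (built [set k | (k <= j)%O])) ->
  dominates G (built D).
Proof.
move=> domD Y.
suff [e0|[j [Dj ej]]] : edges (built D) Y = fset0 \/
    exists j, D j /\ forall e, e \in edges (built D) Y ->
      built [set k | (k <= j)%O] e.
- by rewrite deltaE e0 cardfs0 subr0 lez_nat pdim_le_card.
- apply: le_trans (domD j Dj Y) _; apply: delta_anti => e eY De.
  by apply: ej; rewrite in_edges eY; apply/asboolP.
have : forall e, e \in edges (built D) Y -> built D e.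
  by move=> e; rewrite in_edges => /andP[_ /asboolP].
elim/fset1U_rect: (edges _ _) => [_|e S _ IH DS]; first by left.
right; have [j [Dj je aj]] : built D e by apply: DS; rewrite fset1U1.
have [|S0|[k [Dk Sk]]] := IH.
- by move=> e' e'S; apply: DS; rewrite inE e'S orbT.
- exists j; split=> // e'; rewrite S0 !inE orbF => /eqP ->.
  by exists j; split=> //=.
have [jk|/ltW kj] := leP j k.
  exists k; split=> // e'; rewrite inE => /orP[|/Sk //].
  by rewrite inE => /eqP ->; exists j.
exists j; split=> // e'; rewrite inE => /orP[|/Sk].
  by rewrite inE => /eqP ->; exists j; split=> //=.
by case=> l [/= lk le al]; exists l; split=> //=; exact: le_trans lk kj.
Qed.

Lemma enum_spec i : [/\ closed_in G (f i).2, [set` (f i).1] `<=` (f i).2 &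
  exists2 B, basis G (f i).2 B & #|` (f i).1| = #|` B|.+1].
Proof.
have [[f_in _ _] _ _ _] := f_valid.
have [clF finF AF cardA] := f_in i Logic.I.
have [B bB] := (fin_dim_basis G _).1 finF.
split=> //; exists B => //; move: cardA; rewrite (basis_set_dim bB) -EFinD.
by case=> ->; rewrite addn1.
Qed.

Lemma enum_card i B : basis G (f i).2 B -> #|` (f i).1| = #|` B|.+1.
Proof.
move=> bB; have [_ _ [B' bB' ->]] := enum_spec i.
by have := basis_set_dim bB; rewrite (basis_set_dim bB') => -[->].
Qed.

Lemma enum_surj A F B : closed_in G F -> basis G F B -> [set` A] `<=` F ->
  #|` A| = #|` B|.+1 -> exists j, f j = (A, F).
Proof.
move=> clF bB AF cardA; have [[_ _ f_surj] _ _ _] := f_valid.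
have [|j _ fj] := f_surj (A, F); last by exists j.
split=> //=; first by apply/fin_dim_basis; exists B.
by rewrite (basis_set_dim bB) cardA -addn1 PoszD.
Qed.

Lemma card_lt_enum i j : (#|` (f j).1| < #|` (f i).1|)%N -> (j < i)%O.
Proof. by have [_ _ _ lev] := f_valid => ltc; exact: (lev _ _ ltc). Qed.

(** If the first component A of the j-th pair was added, then A is itself the
    wanted set, as it contains the edge A; if not, its dimension was already
    right at stage j. *)
Lemma enum_tight (D : set I) j : D j -> (forall k, (k < j)%O -> D k) ->
  dominates G (built D) -> #|` (f j).1| = (G (f j).1).+1 ->
  exists2 Z, ((f j).1 `<=` Z)%fset & delta (built D) Z <= (G (f j).1)%:Z.
Proof.
move=> Dj Dlt domD cardA.
have sub e : stage j e -> built D e.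
  by rewrite stage_built => -[k [/= /Dlt Dk ke ak]]; exists k.
have [aj|/contrapT naj] := pselect (added j); last first.
  have domj : dominates G (stage j).
    by move=> Y; apply: le_trans (domD Y) _; apply: delta_anti => e _ /sub.
  have [Z AZ dZ] := (hdim_eq_pdim _ domj).1 naj; exists Z => //.
  by apply: le_trans dZ; apply: delta_anti => e _ /sub.
exists (f j).1 => //; rewrite deltaE.
have : (f j).1 \in edges (built D) (f j).1.
  by rewrite in_edges fsubset_refl; apply/asboolP; exists j.
rewrite -fsub1set => /fsubset_leq_card; rewrite cardfs1; lia.
Qed.

Definition processed i F := forall j, (f j).2 = F -> (j < i)%O.

Lemma processed_saturated i F : dominates G (stage i) ->
  closed_in G F -> fin_dim G F -> processed i F -> saturated G (stage i) F.
Proof.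
move=> domi clF /fin_dim_basis[B bB] procF.
apply: (saturated_of_small domi clF bB) => A AF cardA GA.
have [j fj] := enum_surj clF bB AF cardA.
have ji : (j < i)%O by apply: procF; rewrite fj.
rewrite stage_built in domi *.
have := @enum_tight [set k | (k < i)%O] j ji; rewrite fj /=; apply => //.
  by move=> k kj /=; exact: lt_trans kj ji.
by rewrite cardA GA.
Qed.

(** The levels are increasing, so the pairs over a set of small rank come
    first. *)
Lemma processed_card i F B : basis G F B -> (#|` B|.+1 < #|` (f i).1|)%N ->
  processed i F.
Proof.
move=> bB ltB j jF; apply: card_lt_enum.
by rewrite (@enum_card j B) // jF.
Qed.

(** If the rank of A = (f i).1 were less than |A| - 1, then the closure of A
    would be processed, hence saturated; a tight set around A inside this
    closure shows that A would not have been added. *)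
Lemma added_spec i : dominates G (stage i) -> added i ->
  [/\ #|` (f i).1| = (G (f i).1).+1, (f i).2 = cl_fin G (f i).1
    & forall Z, ((f i).1 `<=` Z)%fset -> (G (f i).1)%:Z + 1 <= delta (stage i) Z].
Proof.
move=> domi ai; have [clF AF [B bB cardA]] := enum_spec i.
have [BF GB maxB] := bB.
have bigZ Z : ((f i).1 `<=` Z)%fset -> (G (f i).1)%:Z + 1 <= delta (stage i) Z.
  move=> AZ; rewrite leNgt; apply/negP => dZ; apply: ai.
  by apply/(hdim_eq_pdim _ domi); exists Z => //; lia.
have GA : G (f i).1 = #|` B|.
  apply/eqP; rewrite eqn_leq -{1}GB maxB //= leqNgt; apply/negP => ltG.
  have [B' bB' GA] := cl_fin_basis G (f i).1.
  have satA : saturated G (stage i) (cl_fin G (f i).1).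
    apply: processed_saturated => //; first exact: closed_cl_fin.
      by apply/fin_dim_basis; exists B'.
    by apply: processed_card bB' _; rewrite cardA -GA.
  have [Z [AZ /pdim_cl_fin GZ tZ]] := satA _ (@sub_cl_fin _ G (f i).1).
  by have := bigZ Z AZ; rewrite /tight in tZ; lia.
split=> //; first by rewrite cardA GA.
by apply: closed_cl_finE => // C /maxB; rewrite GB GA.
Qed.

Lemma stage_sub i j : (j <= i)%O -> stage j `<=` stage i.
Proof.
move=> ji e; rewrite !stage_built => -[k [/= kj ke ak]].
by exists k; split=> //=; exact: lt_le_trans kj ji.
Qed.

Lemma dominates_stage_le i j : (j <= i)%O ->
  dominates G (stage i) -> dominates G (stage j).
Proof.
move=> ji domi Y; apply: le_trans (domi Y) _.
by apply: delta_anti => e _; exact: stage_sub.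
Qed.

(** An edge e was added with a pair over its closure.  The fibre of the closure
    is an interval, so it cannot extend beyond i unless it contains i. *)
Lemma stage_edge i e : dominates G (stage i) -> stage i e ->
  [/\ #|` e| = (G e).+1, exists2 j, (j < i)%O & f j = (e, cl_fin G e)
    & cl_fin G e <> (f i).2 -> processed i (cl_fin G e)].
Proof.
move=> domi; rewrite {1}stage_built => -[j [/= ji <- aj]].
have [cardA FA _] := added_spec (dominates_stage_le (ltW ji) domi) aj.
split=> //; first by exists j => //; rewrite -FA; case: (f j).
move=> neF k kF; rewrite ltNge; apply/negP => ik.
have [_ _ fib _] := f_valid.
apply: neF; apply/esym; apply: (fib _ (closed_cl_fin _ _) j k) => //.
by rewrite (ltW ji) ik.
Qed.

(** The sets E n are (f i).2 and the closures of the edges inside Y; the bound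
    is flat_delta_bound with c = 1.  It is applied to the hypergraph R of the
    edges inside some E n, which has the same edges inside Y: enlarging Y might
    bring in edges that no E n contains. *)
Lemma added_delta_bound i Y : dominates G (stage i) -> added i ->
  ((f i).1 `<=` Y)%fset -> (G Y)%:Z + 1 <= delta (stage i) Y.
Proof.
move=> domi ai AY; have [cardA FA bigZ] := added_spec domi ai.
set A := (f i).1 in AY cardA FA bigZ *; set F := (f i).2 in FA.
pose L : seq (set M) := undup (F :: [seq cl_fin G e | e <- edges (stage i) Y]).
pose E (n : 'I_(size L)) : set M := nth setT L n.
have EP n : exists e, [/\ (e `<=` Y)%fset, E n = cl_fin G e, (G e <= G A)%N
                        & E n <> F -> processed i (E n)].
  have : E n \in L by exact: mem_nth.
  rewrite mem_undup inE => /orP[/eqP ->|/mapP[e]].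
    by exists A; split=> //.
  rewrite in_edges => /andP[eY /asboolP Re] ->.
  have [carde [j ji fj] proce] := stage_edge domi Re.
  exists e; split=> //.
  rewrite -ltnS -carde -cardA leqNgt; apply/negP => ltA.
  have : (i < j)%O by apply: card_lt_enum; rewrite fj.
  by rewrite ltNge (ltW ji).
have E_closed n : closed_in G (E n).
  by have [e [_ -> _ _]] := EP n; exact: closed_cl_fin.
have E_fin n : fin_dim G (E n).
  have [e [_ -> _ _]] := EP n; have [B bB _] := cl_fin_basis G e.
  by apply/fin_dim_basis; exists B.
have E_inj : injective E.
  move=> m n /eqP; rewrite nth_uniq ?undup_uniq // => /eqP mn.
  exact: val_inj.
have FL : F \in L by rewrite mem_undup mem_head.
have FLn : (index F L < size L)%N by rewrite index_mem.
pose i0 := Ordinal FLn.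
have Ei0 : E i0 = F by rewrite /E /= nth_index.
pose R := [set e | stage i e /\ exists n, [set` e] `<=` E n].
have domR : dominates G R.
  by move=> Z; apply: le_trans (domi Z) _; apply: delta_anti => e _ [].
apply: le_trans (_ : delta R Y <= _); last first.
  apply: delta_anti => e eY Re; split=> //.
  have clL : cl_fin G e \in L.
    rewrite mem_undup inE; apply/orP; right; apply: map_f.
    by rewrite in_edges eY; apply/asboolP.
  have cln : (index (cl_fin G e) L < size L)%N by rewrite index_mem.
  by exists (Ordinal cln); rewrite /E /= nth_index //; exact: sub_cl_fin.
apply: (flat_delta_bound domR E_closed E_fin (i0 := i0)) => //.
- by move=> e [].
- move=> s s0 si0.
  have [n ns] := set0Pn _ s0.
  suff sat : saturated G (stage i) (capE E s).
    move=> X /sat[Z [XZ Zs tZ]]; exists Z; split=> //.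
    apply: le_trans tZ; apply: delta_anti => e eZ Re; split=> //.
    exists n; apply: subset_trans_fset eZ _.
    by move=> x /Zs; exact: capE_subE.
  have [B bB] := capE_basis E_fin s0.
  have clE : closed_in G (capE E s) by apply: closed_bigcap => m _.
  apply: processed_saturated => //; first by apply/fin_dim_basis; exists B.
  have [[m ms mn]|nm] := pselect (exists2 m, m \in s & m <> n); last first.
    have sE : s = finset.set1 n.
      apply/finset.setP => m; rewrite inE; apply/idP/eqP => [ms|-> //].
      by apply: contrapT => mn; apply: nm; exists m.
    rewrite sE capE1; have [e [_ _ _]] := EP n; apply; rewrite -Ei0 => /E_inj nE.
    by move: si0; rewrite sE nE eqxx.
  (* E m and E n are distinct closed sets of rank at most G A, so their
     intersection has rank less than G A. *)
  apply: (processed_card bB); rewrite -/A cardA ltnS ltnNge; apply/negP => leB.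
  have [BE GB maxB] := bB.
  have EB p : p \in s -> E p = cl_fin G B.
    move=> ps; apply: closed_cl_finE => //.
      by move=> x /BE; exact: capE_subE.
    have [e [_ -> Ge _]] := EP p => C /pdim_cl_fin GC.
    by rewrite GB; apply: leq_trans GC (leq_trans Ge leB).
  by apply: mn; apply: E_inj; rewrite !EB.
- move=> n; have [e [eY -> _ _]] := EP n => C /pdim_cl_fin GC.
  apply: leq_trans GC _; apply: pdim_mono; apply: sub_restr => //.
  exact: sub_cl_fin.
move=> W YW; rewrite Ei0.
have AW : (A `<=` restr W F)%fset.
  by apply: sub_restr (fsubset_trans AY YW); rewrite FA; exact: sub_cl_fin.
have GW : (G (restr W F) <= G A)%N.
  by apply: pdim_cl_fin; rewrite -FA; exact: restr_subset.
apply: le_trans (_ : delta (stage i) (restr W F) <= _); last first.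
  by apply: delta_anti => e _ [].
by have := bigZ _ AW; lia.
Qed.

Lemma dominates_step i : dominates G (stage i) ->
  dominates G (step G f i (stage i)).
Proof.
move=> domi Y; have [ai|nai] := pselect (added i); last first.
  apply: le_trans (domi Y) _; apply: delta_anti => e _ /stepE[//|[_ /nai//]].
have [AY|nAY] := boolP ((f i).1 `<=` Y)%fset; last first.
  apply: le_trans (domi Y) _; apply: delta_anti => e eY /stepE[//|[eA _]].
  by move: nAY; rewrite eA eY.
have := added_delta_bound domi ai AY; rewrite !deltaE.
have : (edges (step G f i (stage i)) Y `<=` (f i).1 |` edges (stage i) Y)%fset.
  apply/fsubsetP => e; rewrite inE !in_edges inE => /andP[eY /asboolP/stepE].
  rewrite eY => -[se|[-> _]]; last by rewrite eqxx.
  by apply/orP; right; apply/asboolP.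
move=> /fsubset_leq_card; rewrite cardfsU1; lia.
Qed.

Lemma dominates_stage i : dominates G (stage i).
Proof.
elim/(well_founded_ind (well_order_wf I_wo)): i => i IH.
rewrite stage_built; apply: dominates_built => j ji.
by rewrite -step_built; apply: dominates_step; exact: IH.
Qed.

(** Every pair has been treated, so the closure of X is saturated, and a tight
    set around X inside it attains the dimension of X. *)
Lemma f_construction_good : good_representation (f_construction G f I_wo) G.
Proof.
rewrite f_construction_built.
have domR : dominates G (built setT).
  apply: dominates_built => j _; rewrite -step_built.
  exact/dominates_step/dominates_stage.
have hdimE X : hdim (built setT) X = ((G X)%:Z)%:E.
  apply/(hdim_eq_pdim _ domR).
  have [B bB GX] := cl_fin_basis G X.
  have satX : saturated G (built setT) (cl_fin G X).
    apply: (saturated_of_small domR (@closed_cl_fin _ _ _) bB) => A AF cardA GA.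
    have [j fj] := enum_surj (@closed_cl_fin _ _ _) bB AF cardA.
    have := @enum_tight setT j; rewrite fj /=; apply => //.
    by rewrite cardA GA.
  have [Z [XZ /pdim_cl_fin GZ tZ]] := satX _ (@sub_cl_fin _ G X).
  by exists Z => //; rewrite /tight in tZ; lia.
have edge e : built setT e -> #|` e| = (G e).+1.
  move=> [j [_ <- aj]].
  by have [-> _ _] := added_spec (dominates_stage j) aj.
split=> // e /edge carde; first by rewrite -cardfs_gt0 carde.
by rewrite hdimE carde; congr EFin; lia.
Qed.

End Construction.

Theorem proposition2p4p7 (M : choiceType) (G : pregeometry M) (G_flat : flat G)
    (disp : Order.disp_t) (I : orderType disp)
    (I_wo : well_order (@Order.le disp I))
    (f : I -> {fset M} * set M) (f_valid : valid_enumeration G f) :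
  good_representation (f_construction G f I_wo) G.
Proof. exact: f_construction_good. Qed.
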